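(* Let $d\ge 2$ and let $p=(p_1,\dots,p_d)\in[0,1]^d$ be a vector of splitting probabilities (a probability vector). Let $l_n$, $n\ge0$, be the collision resolution interval length of the $d$-ary tree algorithm with successive interference cancellation (SICTA) with splitting probabilities $p$, started with $n$ users. Define for $x,z\in\mathbb{C}$ $$\widetilde{Q}(x,z)=\sum_{n\ge 0}\frac{x^n}{n!}\,\mathbb{E}\big[z^{l_n}\big].$$ It then holds that $$\widetilde{Q}(x,z)=\prod_{i=1}^d \widetilde{Q}(xp_i,z)+\sum_{k=0}^{d-2}(z-z^2)\big(1+\overline{F}(k)x\big)\prod_{i=1}^k \widetilde{Q}(xp_i,z),$$ where $\overline{F}(k)=\sum_{j=k+1}^d p_j$ (and the empty product, for $k=0$, equals $1$).
   Context: Definition of $l_n$. For $n\ge 2$ let $(I_1,\dots,I_d)$ be multinomially distributed with $n$ trials and cell probabilities $p=(p_1,\dots,p_d)$ ($I_j$ is the number of the $n$ users choosing slot $j$), and let $$M=\inf\Big\{k\in\{1,\dots,d\}:\ \sum_{j=1}^k I_j\ge n-1\Big\}.$$ The random variables $l_n$ are defined recursively by $l_n=1$ for $n=0,1$ and, for $n\ge 2$, $$l_n=\mathbf{1}\{M<d\}+\sum_{j=1}^{M} l_{I_j},$$ where, given $(I_1,\dots,I_d)$, the variables $l_{I_1},\dots,l_{I_d}$ on the right are independent, $l_{I_j}$ having the law of $l_m$ with $m=I_j$.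
   Formalization: The identity is stated for those x, z for which all E[z^{l_n}] exist and the series for Q̃(x,z) converges (proved for all x when |z|≤1), since for e.g. d=2, p=(1/2,1/2), z=2 one has E[z^{l_2}]=∞; l_n may take the value ∞ (when some p_j=1), with z^∞=0. *)

(* Defs.v *)
(* MathComp-Analysis; complex numbers are [R[i]] (mathcomp-real-closed) over
   [R : realType]. *)
From HB Require Import structures.
From mathcomp Require Import all_boot all_order all_algebra.
From mathcomp Require Import all_classical all_reals all_analysis.
From mathcomp Require Import complex.

Set Implicit Arguments.
Unset Strict Implicit.
Unset Printing Implicit Defensive.

Import Order.TTheory GRing.Theory Num.Theory.
Import numFieldNormedType.Exports.

Local Open Scope classical_set_scope.
Local Open Scope ring_scope.
Local Open Scope complex_scope.

(* The extended naturals, [None] being infinity.  The value infinity cannot be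
   dispensed with: if some p_j is 1 then all users always choose the same slot
   and l_n is infinite almost surely for every n >= 2. *)
Definition enat : Type := option nat.
HB.instance Definition _ := Choice.on enat.
HB.instance Definition _ := isPointed.Build enat (Some 0%N).
HB.instance Definition _ := @isMeasurable.Build default_measure_display
  enat (@discrete_measurable enat) (@discrete_measurable0 enat)
  (@discrete_measurableC enat) (@discrete_measurableU enat).

Definition enat_add (a b : enat) : enat :=
  match a, b with
  | Some m, Some n => Some (m + n)%N
  | _, _ => None
  end.

Fact enat_addA : associative enat_add.
Proof. by move=> [a|] [b|] [c|] //=; rewrite addnA. Qed.
Fact enat_addC : commutative enat_add.
Proof. by move=> [a|] [b|] //=; rewrite addnC. Qed.
Fact enat_add0 : left_id (Some 0%N) enat_add.
Proof. by move=> [a|]. Qed.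
HB.instance Definition _ :=
  Monoid.isComLaw.Build enat (Some 0%N) enat_add enat_addA enat_addC enat_add0.

(* Slots 1, ..., d are the ordinals 0, ..., d-1; "slot j is among the first k"
   is [(j < k)%N]. *)

Definition splitting_probability (R : realType) (d : nat) (p : 'I_d -> R) :=
  (forall j, 0 <= p j) /\ \sum_(j < d) p j = 1.

Definition multinomial_pmf (R : realType) (d : nat) (p : 'I_d -> R) (n : nat)
    (i : 'I_d -> nat) : R :=
  if (\sum_(j < d) i j == n)%N
  then n`!%:R / (\prod_(j < d) (i j)`!)%:R * \prod_(j < d) p j ^+ i j
  else 0.

(* M = min {k in {1..d} : i_1 + ... + i_k >= n - 1}.  Using d as the neutral
   element is harmless, since k = d qualifies whenever the i_j sum to n. *)
Definition stop_slot (d n : nat) (i : 'I_d -> nat) : nat :=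
  \big[minn/d]_(1 <= k < d.+1 | (n - 1 <= \sum_(j < d | j < k) i j)%N) k.

(* 1{M < d} + l_1 + ... + l_M *)
Definition sicta_rhs (d n : nat) (i : 'I_d -> nat) (l : 'I_d -> enat) : enat :=
  enat_add (Some ((stop_slot n i < d)%N : nat))
    (\big[enat_add/Some 0%N]_(j < d | (j < stop_slot n i)%N) l j).

Section SICTA.
Context (R : realType) (dT : measure_display) (T : measurableType dT).
Variable P : probability T R.

(* [I n j] is the number of the n users choosing slot j, and [L n j] is the
   variable written l_{I_j} in the recursion for l_n: given
   (I_1, ..., I_d) = (i_1, ..., i_d), the [L n j] are independent and [L n j]
   has the law of l_(i_j).  All variables being discrete, conditional laws are
   given by point masses. *)
Record sicta_recursion (d : nat) (p : 'I_d -> R) (l : nat -> {RV P >-> enat})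
    (I : nat -> 'I_d -> {RV P >-> nat}) (L : nat -> 'I_d -> {RV P >-> enat}) :
    Prop := {
  sicta_init : forall n, (n < 2)%N -> {ae P, forall w, l n w = Some 1%N} ;
  sicta_multinomial : forall n, (2 <= n)%N -> forall i : 'I_d -> nat,
    P [set w | forall j, I n j w = i j] = (multinomial_pmf p n i)%:E ;
  sicta_cond_indep : forall n, (2 <= n)%N ->
    forall (i : 'I_d -> nat) (v : 'I_d -> enat),
    P ([set w | forall j, I n j w = i j] `&` [set w | forall j, L n j w = v j])
    = (P [set w | forall j, I n j w = i j] *
       \prod_(j < d) P [set w | l (i j) w = v j])%E ;
  sicta_step : forall n, (2 <= n)%N ->
    {ae P, forall w, l n w = sicta_rhs n (fun j => I n j w) (fun j => L n j w)}
}.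

Definition complex_integrable (X : T -> R[i]) : Prop :=
  P.-integrable setT (fun w => (complex.Re (X w))%:E) /\
  P.-integrable setT (fun w => (complex.Im (X w))%:E).

Definition complex_expectation (X : T -> R[i]) : R[i] :=
  fine 'E_P[fun w => complex.Re (X w)] +i* fine 'E_P[fun w => complex.Im (X w)].

(* z ^ infinity is read as 0, its only sensible value when |z| < 1 *)
Definition epow (z : R[i]) (a : enat) : R[i] := if a is Some k then z ^+ k else 0.

(* [R[i]^o] is R[i] with the topology of its norm *)
Definition Qterm (l : nat -> {RV P >-> enat}) (x z : R[i]) (n : nat) : R[i]^o :=
  x ^+ n / n`!%:R * complex_expectation (fun w => epow z (l n w)).

Definition Qtilde (l : nat -> {RV P >-> enat}) (x z : R[i]) : R[i] :=
  limn (series (Qterm l x z)).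

(* [Qtilde l x z] is meaningful: its expectations exist and its series
   converges.  This may fail for |z| > 1: with d = 2 and p = (1/2, 1/2) the
   variable z ^ l_2 is not integrable once |z| >= 2. *)
Definition Qtilde_defined (l : nat -> {RV P >-> enat}) (x z : R[i]) : Prop :=
  (forall n, complex_integrable (fun w => epow z (l n w))) /\
  cvgn (series (Qterm l x z)).

End SICTA.

Definition Fbar (R : realType) (d : nat) (p : 'I_d -> R) (k : nat) : R :=
  \sum_(j < d | (k <= j)%N) p j.

(* Main.v *)
Require Import Defs.
From HB Require Import structures.
From mathcomp Require Import all_boot all_order all_algebra.
From mathcomp Require Import all_classical all_reals all_analysis.
From mathcomp Require Import complex measurable_realfun.
Import Order.TTheory GRing.Theory Num.Theory.
Import numFieldNormedType.Exports.
Local Open Scope ring_scope.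
Local Open Scope complex_scope.

(** Write [a_n] for the expectation of [z ^ l_n].  Conditioning on the occupation
    numbers [f] of the slots, the recursion for [l_n] becomes, for [n >= 2],
      [a_n = sum_f P(I = f) * z ^ 1{M < d} * prod_(j <= M) a_(f_j)]
    ([pgf_recursion]).  It is first proved for point masses ([law_recursion]),
    where independent lengths enter through finite convolutions, and then summed by
    Cauchy products.

    The stopping slot [M] depends on [f] in an awkward way and is eliminated by a
    telescoping sum ([stopped_prodE]).  After [M] slots at most one user is left,
    so that every later slot contributes a factor [a_0 = a_1 = z]; hence the
    stopped product is the product over all slots plus the sum of
    [(z - z ^ 2) * prod_(j <= k) a_(f_j)] over those [k <= d - 2] for which at most
    one user is left after [k] slots.  In this form the recursion also holds for
    [n = 0, 1].

    Multiplied by [x ^ n / n!], the multinomial probabilities become products of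
    weights [(x * p_j) ^ f_j / f_j!], one for each slot.  The product over all
    slots then yields the Cauchy product of the series [Q (x * p_j)].  In the term
    of index [k], the slots after the [k]-th are either all empty or hold a single
    user, which yields the factor [1 + Fbar(k) * x] ([sum_slots_tail_le1]).  This
    is the functional equation for the coefficients ([coefficient_identity]).

    Summing over [n] requires absolute convergence at the points [x * p_j].  Where
    [p_j < 1] it follows from convergence at [x] by Abel's lemma.  If [p_j = 1],
    all users collide forever, [l_n] is infinite for [n >= 2] and the series is a
    polynomial ([Qterm_slot_abs_cvg]).  On the closed unit disc the coefficients
    [a_n] are bounded, and the series is dominated by an exponential series. *)

(** * Absolutely convergent complex series *)

Section AbsoluteSums.
Context {R : realType}.
Local Notation C := R[i].
Local Open Scope classical_set_scope.
Implicit Types u v : nat -> C.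

Definition cmod (z : C) : R := ComplexField.Normc.normc z.

Lemma cmodE z : `|z| = (cmod z)%:C.
Proof. by case: z. Qed.

Lemma cmod_ge0 z : 0 <= cmod z.
Proof. by case: z => a b; exact: sqrtr_ge0. Qed.

Lemma cmodD z w : cmod (z + w) <= cmod z + cmod w.
Proof. exact: le_normcD. Qed.

Lemma cmodM z w : cmod (z * w) = cmod z * cmod w.
Proof. exact: ComplexField.Normc.normcM. Qed.

Lemma cmodN z : cmod (- z) = cmod z.
Proof. exact: normcN. Qed.

Lemma cmod0 : cmod 0 = 0.
Proof. exact: ComplexField.Normc.normc0. Qed.

Lemma cmod1 : cmod 1 = 1.
Proof. exact: ComplexField.Normc.normc1. Qed.

Lemma cmodX z n : cmod (z ^+ n) = cmod z ^+ n.
Proof. by elim: n => [|n IH]; rewrite ?cmod1 // !exprS cmodM IH. Qed.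

Lemma cmod_real (a : R) : cmod a%:C = `|a|.
Proof. by rewrite /cmod /= expr0n /= addr0 sqrtr_sqr. Qed.

Lemma cmod_sum I (r : seq I) (Q : pred I) (F : I -> C) :
  cmod (\sum_(i <- r | Q i) F i) <= \sum_(i <- r | Q i) cmod (F i).
Proof.
elim/big_ind2: _ => [|x a y b xa yb|//]; first by rewrite cmod0.
by rewrite (le_trans (cmodD _ _)) // lerD.
Qed.

Lemma Re_le_cmod (z : C) : `|complex.Re z| <= cmod z.
Proof. by have := normc_ge_Re z; rewrite cmodE lecR. Qed.

Lemma Im_le_cmod (z : C) : `|complex.Im z| <= cmod z.
Proof.
case: z => a b; rewrite /cmod /= -[`|b|]sqrtr_sqr ler_sqrt ?addr_ge0 ?sqr_ge0//.
by rewrite lerDr sqr_ge0.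
Qed.

Lemma cmod_le_ReIm (z : C) :
  cmod z <= `|complex.Re z| + `|complex.Im z|.
Proof.
case: z => a b; rewrite -[leRHS]ger0_norm ?addr_ge0// -[leRHS]sqrtr_sqr.
rewrite /cmod /= ler_sqrt ?sqr_ge0// sqrrD !real_normK ?num_real//.
by rewrite addrAC lerDl mulrn_wge0// mulr_ge0.
Qed.

(** Order and completeness arguments take place in [R]; real majorants of the
    modulus carry them over to the norm topology of [C]. *)
Lemma cvg_dominated (u : nat -> C^o) (s : C^o) (e : nat -> R) :
  (forall n, cmod (u n - s) <= e n) -> e @ \oo --> (0 : R) -> u @ \oo --> s.
Proof.
move=> ue e0; apply/cvgrPdist_lt => eps eps0.
have epsE : eps = (complex.Re eps)%:C by rewrite RRe_real// gtr0_real.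
have eps0' : 0 < complex.Re eps by rewrite -ltcR -epsE.
move/cvgr0Pnorm_lt : e0 => /(_ _ eps0'); apply: filterS => n en.
rewrite epsE distrC (cmodE (u n - s)) ltcR (le_lt_trans (ue n))//.
by rewrite (le_lt_trans _ en)// ler_norm.
Qed.

Lemma cvg_complex u (a b : R) :
  (fun n => complex.Re (u n)) @ \oo --> a ->
  (fun n => complex.Im (u n)) @ \oo --> b -> (u : nat -> C^o) @ \oo --> (a +i* b : C^o).
Proof.
move=> ua ub.
apply: (@cvg_dominated _ _
  (fun n => `|complex.Re (u n) - a| + `|complex.Im (u n) - b|)).
  by move=> n; apply: le_trans (cmod_le_ReIm _) _; case: (u n).
have dist0 (v : nat -> R) (c : R) : v @ \oo --> c -> (fun n => `|v n - c|) @ \oo --> 0.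
  move=> vc; rewrite -[0](@normr0 _ R) -(subrr c).
  by apply: cvg_norm; apply: cvgB => //; exact: cvg_cst.
by rewrite -[0]addr0; apply: cvgD; exact: dist0.
Qed.

(** The moduli are kept because Cauchy products need them, and the sum is a limit
    in [C^o], the space in which [Qtilde] is defined. *)
Definition abs_sum u (s : C) :=
  cvgn (series (fun n => cmod (u n))) /\
  (series (u : nat -> C^o) @ \oo --> (s : C^o)).

Lemma Re_sum I (r : seq I) (Q : pred I) (F : I -> C) :
  complex.Re (\sum_(i <- r | Q i) F i) = \sum_(i <- r | Q i) complex.Re (F i).
Proof.
by elim/big_rec2: _ => // i a b _ <-; case: (F i) b => x y [].
Qed.
Lemma Im_sum I (r : seq I) (Q : pred I) (F : I -> C) :
  complex.Im (\sum_(i <- r | Q i) F i) = \sum_(i <- r | Q i) complex.Im (F i).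
Proof.
by elim/big_rec2: _ => // i a b _ <-; case: (F i) b => x y [].
Qed.

Lemma abs_sum_exists u : cvgn (series (fun n => cmod (u n))) ->
  abs_sum u (limn (series (fun n => complex.Re (u n))) +i*
             limn (series (fun n => complex.Im (u n)))).
Proof.
move=> cu; split=> //; apply: cvg_complex.
  under eq_cvg do rewrite /series /= Re_sum.
  apply: normed_cvg; apply: series_le_cvg cu => n;
    by [exact: normr_ge0 | exact: cmod_ge0 | exact: Re_le_cmod].
under eq_cvg do rewrite /series /= Im_sum.
apply: normed_cvg; apply: series_le_cvg cu => n;
  by [exact: normr_ge0 | exact: cmod_ge0 | exact: Im_le_cmod].
Qed.

Lemma abs_sum_unique u s t : abs_sum u s -> abs_sum u t -> s = t.
Proof. by move=> [_ us] [_ ut]; exact: (cvg_unique (@norm_hausdorff _ C^o) us ut). Qed.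

Lemma abs_sum_lim u s : abs_sum u s -> limn (series (u : nat -> C^o)) = s.
Proof. by move=> [_ us]; apply: cvg_lim us; exact: norm_hausdorff. Qed.

Lemma eq_abs_sum u v s : u =1 v -> abs_sum u s -> abs_sum v s.
Proof. by move=> /funext ->. Qed.

Lemma abs_sum_le u (v : nat -> R) :
  (forall n, cmod (u n) <= v n) -> cvgn (series v) ->
  cvgn (series (fun n => cmod (u n))).
Proof.
move=> uv; apply: series_le_cvg => // n; first exact: cmod_ge0.
exact: le_trans (cmod_ge0 _) (uv n).
Qed.

Lemma abs_sumD u v s t : abs_sum u s -> abs_sum v t ->
  abs_sum (fun n => u n + v n) (s + t).
Proof.
move=> [cu us] [cv vt]; split.
  apply: (@abs_sum_le _ ((fun n => cmod (u n)) + (fun n => cmod (v n)))).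
    by move=> n; exact: cmodD.
  by rewrite seriesD; exact: is_cvgD.
have -> : series ((fun n => u n + v n) : nat -> C^o) =
    series (u : nat -> C^o) + series (v : nat -> C^o).
  by apply/funext => n; rewrite /series /= fctE big_split.
exact: (@cvgD C C^o _ _ _ (series (u : nat -> C^o)) (series (v : nat -> C^o)) s t us vt).
Qed.

Lemma abs_sumZ u s (c : C) : abs_sum u s -> abs_sum (fun n => c * u n) (c * s).
Proof.
move=> [cu us]; split.
  apply: (@abs_sum_le _ (cmod c *: (fun n => cmod (u n)) : nat -> R^o)).
    by move=> n; rewrite cmodM.
  by rewrite seriesZ; exact: is_cvgZl_tmp.
have -> : series ((fun n => c * u n) : nat -> C^o) =
    (fun n => c * series (u : nat -> C^o) n).
  by apply/funext => n; rewrite /series /= mulr_sumr.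
exact: (@cvgM C nat \oo _ (cst c) (series (u : nat -> C^o)) c s (cvg_cst _) us).
Qed.

Lemma abs_sum_finite u N : (forall n, (N <= n)%N -> u n = 0) ->
  abs_sum u (\sum_(0 <= n < N) u n).
Proof.
move=> u0; split.
  apply: (@cvgP _ _ (series (fun n => cmod (u n)) N)).
  apply: cvg_near_cst; exists N => // n /= Nn.
  rewrite /series /= (big_cat_nat (n := N))//= [X in _ + X]big_nat.
  rewrite [X in _ + X]big1 ?addr0// => i /andP[Ni _].
  by rewrite u0// cmod0.
apply: cvg_near_cst; exists N => // n /= Nn.
rewrite /series /= (big_cat_nat (n := N))//= [X in _ + X]big_nat.
by rewrite [X in _ + X]big1 ?addr0// => i /andP[Ni _]; rewrite u0.
Qed.

Lemma abs_sum0 : abs_sum (fun=> 0) 0.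
Proof.
rewrite [X in abs_sum _ X](_ : 0 = \sum_(0 <= n < 0) (0 : C)); last by rewrite big_geq.
exact: (@abs_sum_finite (fun=> 0)).
Qed.

Lemma abs_sum_bigsum (I : Type) (r : seq I) (Q : pred I) (u : I -> nat -> C) s :
  (forall i, Q i -> abs_sum (u i) (s i)) ->
  abs_sum (fun n => \sum_(i <- r | Q i) u i n) (\sum_(i <- r | Q i) s i).
Proof.
move=> us; elim: r => [|i r IH].
  rewrite [X in abs_sum _ X]big_nil.
  by apply: eq_abs_sum abs_sum0 => n; rewrite big_nil.
apply: (@eq_abs_sum (fun n => (if Q i then u i n else 0) +
    \sum_(i <- r | Q i) u i n)).
  by move=> n; rewrite big_cons; case: ifP => //; rewrite add0r.
rewrite big_cons; case: ifPn => Qi; first exact: abs_sumD (us _ Qi) IH.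
by apply: eq_abs_sum IH => n; rewrite add0r.
Qed.
End AbsoluteSums.

(** * Cauchy products *)

Section CauchyProduct.
Context {R : realType}.
Local Notation C := R[i].
Local Open Scope classical_set_scope.

Definition cauchy_product {K : pzSemiRingType} (u v : nat -> K) (n : nat) : K :=
  \sum_(i < n.+1) u i * v (n - i)%N.

(** The triangle is summed by rows: going from [N] to [N + 1] adds one term to
    each row, and these terms make up the new diagonal. *)
Lemma cauchy_product_partial {K : pzSemiRingType} (u v : nat -> K) N :
  \sum_(k < N) cauchy_product u v k =
  \sum_(i < N) u i * \sum_(j < N - i) v j.
Proof.
elim: N => [|N IH]; first by rewrite !big_ord0.
rewrite [LHS]big_ord_recr [RHS]big_ord_recr /= IH subSnn big_ord1.
rewrite /cauchy_product big_ord_recr /= subnn addrA -big_split /=.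
congr (_ + _); apply: eq_bigr => i _.
by rewrite subSn ?(ltnW (ltn_ord i))// big_ord_recr /= mulrDr.
Qed.

Lemma sum_ord_sub {V : zmodType} (c : nat -> V) m n : (m <= n)%N ->
  \sum_(i < n) c i - \sum_(i < m) c i = \sum_(i < n - m) c (m + i)%N.
Proof.
by move=> /subnKC; move: (n - m)%N => k <-; rewrite big_split_ord /= addrAC subrr add0r.
Qed.

Section NonnegativeProduct.
Variables a b : nat -> R.
Hypotheses (a0 : forall n, 0 <= a n) (b0 : forall n, 0 <= b n).

Lemma partial_sum_le (c : nat -> R) m n : (forall n, 0 <= c n) ->
  (m <= n)%N -> \sum_(i < m) c i <= \sum_(i < n) c i.
Proof.
move=> c0 /subnKC <-; rewrite big_split_ord /= lerDl.
by apply: sumr_ge0 => i _.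
Qed.

Lemma cauchy_product_partial_le N :
  \sum_(k < N) cauchy_product a b k <= (\sum_(i < N) a i) * \sum_(j < N) b j.
Proof.
rewrite cauchy_product_partial mulr_suml; apply: ler_sum => i _.
by rewrite ler_wpM2l// partial_sum_le// leq_subr.
Qed.

(** The triangle of side [N] contains the square of side [N./2]. *)
Lemma cauchy_product_partial_ge N :
  (\sum_(i < N./2) a i) * (\sum_(j < N./2) b j) <=
  \sum_(k < N) cauchy_product a b k.
Proof.
have hN : (N./2 <= N)%N by rewrite -{2}(odd_double_half N) -addnn addnA leq_addl.
rewrite cauchy_product_partial.
apply: le_trans (_ : \sum_(i < N./2) a i * \sum_(j < N - i) b j <= _).
  rewrite mulr_suml; apply: ler_sum => i _; rewrite ler_wpM2l// partial_sum_le//.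
  have iN := ltn_ord i; rewrite leq_subRL; last exact: leq_trans (ltnW iN) hN.
  rewrite -[leqRHS]odd_double_half -addnn addnA leq_add2r.
  by rewrite (leq_trans (ltnW iN))// leq_addl.
pose c i := a i * \sum_(j < N - i) b j.
by apply: (partial_sum_le c) => // n; rewrite mulr_ge0// sumr_ge0.
Qed.

Hypotheses (ca : cvgn (series a)) (cb : cvgn (series b)).

Lemma cvg_half (u : nat -> R) (s : R) : u @ \oo --> s ->
  (fun n => u n./2) @ \oo --> s.
Proof.
move=> us; apply: (cvg_comp _ _ _ us) => A [N _ NA]; exists N.*2 => // n /= Nn.
by apply: NA => /=; rewrite -(doubleK N) half_leq.
Qed.

Lemma cvg_cauchy_product_nonneg :
  series (cauchy_product a b) @ \oo --> limn (series a) * limn (series b).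
Proof.
have cab : (fun n => series a n * series b n) @ \oo -->
    limn (series a) * limn (series b) by exact: cvgM.
apply: (squeeze_cvgr _ (cvg_half _ _ cab) cab); apply: nearW => N.
rewrite /series /= !big_mkord.
by rewrite cauchy_product_partial_ge cauchy_product_partial_le.
Qed.

End NonnegativeProduct.

(** The error of the triangular partial sum against the square one is bounded
    by the same error for the moduli, which tends to zero because both partial
    sums of the moduli have the same limit. *)
Lemma abs_sum_cauchy_product (u v : nat -> C) s t :
  abs_sum u s -> abs_sum v t -> abs_sum (cauchy_product u v) (s * t).
Proof.
move=> [cu us] [cv vt].
pose a n := cmod (u n); pose b n := cmod (v n).
have a0 n : 0 <= a n by exact: cmod_ge0.
have b0 n : 0 <= b n by exact: cmod_ge0.
have cab := cvg_cauchy_product_nonneg a b a0 b0 cu cv.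
split.
  apply: (@abs_sum_le _ _ (cauchy_product a b)).
    move=> n; apply: le_trans (cmod_sum _ _ _ _) _.
    by apply: ler_sum => i _; rewrite cmodM.
  exact: cvgP cab.
have sq : (fun n => series (u : nat -> C^o) n * series (v : nat -> C^o) n : C^o)
    @ \oo --> (s * t : C^o).
  exact: (@cvgM C nat \oo _ (series (u : nat -> C^o)) (series (v : nat -> C^o)) s t us vt).
pose err n : C^o := series (cauchy_product u v : nat -> C^o) n -
  series (u : nat -> C^o) n * series (v : nat -> C^o) n.
have err0 : err @ \oo --> (0 : C^o).
  apply: (@cvg_dominated _ _ _
    (fun n => series a n * series b n - series (cauchy_product a b) n)).
    move=> n; rewrite /err subr0 /series /= !big_mkord !cauchy_product_partial.
    rewrite !mulr_suml -!sumrB; apply: le_trans (cmod_sum _ _ _ _) _.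
    apply: ler_sum => i _; rewrite -!mulrBr cmodM ler_wpM2l ?cmod_ge0//.
    have ni : (n - i <= n)%N by exact: leq_subr.
    by rewrite -opprB cmodN !(sum_ord_sub _ _ _ ni) cmod_sum.
  rewrite -(subrr (limn (series a) * limn (series b))).
  by apply: cvgB => //; exact: cvgM.
have -> : series (cauchy_product u v : nat -> C^o) =
    (fun n => series (u : nat -> C^o) n * series (v : nat -> C^o) n : C^o) + err.
  by apply/funext => n; rewrite /err !fctE addrC subrK.
rewrite -[s * t]addr0.
exact: (@cvgD C C^o _ _ _ _ err (s * t) 0 sq err0).
Qed.

(** The [n]-th term of an iterated Cauchy product is the coefficient of ['X^n] in
    a product of polynomials obtained by truncation; where the truncation occurs
    does not matter beyond [n]. *)
Lemma coef_prod_poly_trunc {K : comNzRingType} (J : Type) (r : seq J) (Q : pred J)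
    (F : J -> nat -> K) m n : (m <= n)%N ->
  (\prod_(j <- r | Q j) \poly_(i < n.+1) F j i)`_m =
  (\prod_(j <- r | Q j) \poly_(i < m.+1) F j i)`_m.
Proof.
elim: r m n => [|j r IH] m n mn; first by rewrite !big_nil.
rewrite !big_cons; case: (Q j); last exact: IH.
rewrite !coefM; apply: eq_bigr => i _.
have im : (i <= m)%N by rewrite -ltnS.
rewrite !coef_poly !ltnS im (leq_trans im mn); congr (_ * _).
have mim : (m - i <= m)%N by exact: leq_subr.
by rewrite (IH _ _ (leq_trans mim mn)) (IH _ _ mim).
Qed.

Lemma abs_sum_prod (J : Type) (r : seq J) (Q : pred J) (F : J -> nat -> C)
    (s : J -> C) :
  (forall j, Q j -> abs_sum (F j) (s j)) ->
  abs_sum (fun n => (\prod_(j <- r | Q j) \poly_(i < n.+1) F j i)`_n)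
          (\prod_(j <- r | Q j) s j).
Proof.
move=> Fs; elim: r => [|j r IH].
  rewrite big_nil; have := @abs_sum_finite R (fun n => (n == 0%N)%:R) 1%N.
  rewrite big_nat1 eqxx => h; apply: eq_abs_sum (h _); last by case.
  by move=> n; rewrite big_nil coef1.
rewrite big_cons; case: ifPn => Qj; last first.
  by apply: eq_abs_sum IH => n; rewrite big_cons (negPf Qj).
apply: eq_abs_sum (abs_sum_cauchy_product _ _ _ _ (Fs j Qj) IH).
move=> n; rewrite big_cons Qj coefM; apply: eq_bigr => i _.
have ni : (n - i <= n)%N by exact: leq_subr.
by rewrite coef_poly ltn_ord (coef_prod_poly_trunc _ _ _ _ _ _ ni).
Qed.

(** A Cauchy product with the two-term series [1, c]: the hypothesis on [u] says
    that the coefficient of ['X^n] is already correct in [u n]. *)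
Lemma abs_sum_linear_factor (c : C) (u : nat -> {poly C}) s :
  abs_sum (fun n => (u n)`_n) s ->
  (forall n, (u n.+1)`_n = (u n)`_n) ->
  abs_sum (fun n => ((1 + c *: 'X) * u n)`_n) ((1 + c) * s).
Proof.
move=> us uS.
pose e n : C := (n == 0%N)%:R + c * (n == 1%N)%:R.
have eE n : (1 + c *: 'X : {poly C})`_n = e n.
  by rewrite coefD coef1 coefZ coefX.
have esum : abs_sum e (1 + c).
  have -> : 1 + c = \sum_(0 <= n < 2) e n.
    by rewrite /e big_nat_recr//= big_nat1 /= mulr0 mulr1 addr0 add0r.
  by apply: abs_sum_finite => -[|[|n]] // _; rewrite /e mulr0 addr0.
apply: eq_abs_sum (abs_sum_cauchy_product _ _ _ _ esum us) => -[|n].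
  by rewrite coefM /cauchy_product !big_ord1 eE.
rewrite coefM /cauchy_product !big_ord_recl !big1 => [|i _|i _].
- by rewrite !eE !subSS !subn0 uS.
- by rewrite eE /e mulr0 addr0 mul0r.
- by rewrite /e mulr0 addr0 mul0r.
Qed.

(** Abel: the terms of a convergent power series are bounded, so that at a point
    closer to the origin they are dominated by a geometric series. *)
Lemma abs_cvg_power_series (a : nat -> C) (x : C) (t : R) :
  0 <= t < 1 ->
  cvgn (series ((fun n => x ^+ n * a n) : nat -> C^o)) ->
  cvgn (series (fun n => cmod ((x * t%:C) ^+ n * a n))).
Proof.
move=> /andP[t0 t1] /cvg_series_cvg_0/cvgP/cvg_seq_bounded.
move=> [M [_ /(_ (M + 1))]]; rewrite ltrDl ltr01 => /(_ isT) xM.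
have {}xM n : cmod (x ^+ n * a n) <= complex.Re (M + 1).
  by have := xM n I; rewrite /= cmodE lecE => /andP[_ /=].
apply: (abs_sum_le _ (geometric (complex.Re (M + 1)) t)); last first.
  by apply: is_cvg_geometric_series; rewrite ger0_norm.
move=> n /=; rewrite exprMn -rmorphXn mulrAC cmodM cmod_real.
by rewrite ger0_norm ?exprn_ge0// ler_wpM2r// exprn_ge0.
Qed.

End CauchyProduct.

(** * The stopping slot *)

Section StoppingSlot.
Variables (d n : nat) (f : 'I_d -> nat).

Lemma bigmin_leq (r : seq nat) (Q : pred nat) m :
  (\big[minn/d]_(k <- r | Q k) k <= m)%N =
  (d <= m)%N || has (fun k => Q k && (k <= m)%N) r.
Proof.
elim: r => [|k r IH]; first by rewrite big_nil orbF.
by rewrite big_cons /=; case: (Q k) => //=; rewrite geq_min IH orbCA.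
Qed.

Lemma stop_slot_le : (stop_slot n f <= d)%N.
Proof. by rewrite /stop_slot bigmin_leq leqnn. Qed.

Lemma slots_before_mono k m : (k <= m)%N ->
  (\sum_(j < d | j < k) f j <= \sum_(j < d | j < m) f j)%N.
Proof.
move=> km; rewrite [leqLHS]big_mkcond [leqRHS]big_mkcond; apply: leq_sum => j _.
by case: (ltnP j k) => // jk; rewrite (leq_trans jk km).
Qed.

Hypothesis sum_f : (\sum_(j < d) f j = n)%N.

Lemma slots_before_all k : (d <= k)%N -> (\sum_(j < d | j < k) f j = n)%N.
Proof.
by move=> dk; rewrite -[RHS]sum_f; apply: eq_bigl => j; rewrite (leq_trans (ltn_ord j)).
Qed.

(** The number of users in the first [k] slots is nondecreasing in [k], so the
    infimum defining the stopping slot is at most [k] as soon as [k] meets the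
    threshold.  The value [k = 0] is not in the range of the infimum, but for
    [n >= 2] it does not meet the threshold either. *)
Lemma stop_slotP k : (2 <= n)%N ->
  (stop_slot n f <= k)%N = (n - 1 <= \sum_(j < d | j < k) f j)%N.
Proof.
move=> n2; rewrite /stop_slot bigmin_leq.
have [dk|kd] := leqP d k; first by rewrite slots_before_all// leq_subr.
apply/hasP/idP => [[i _ /andP[iS ik]]|kS].
  exact: leq_trans iS (slots_before_mono _ _ ik).
exists k; last by rewrite kS leqnn.
rewrite mem_index_iota ltnS (ltnW kd) andbT lt0n; apply: contraTneq kS => ->.
by rewrite big_pred0// leqn0 subn_eq0 -ltnNge.
Qed.

Lemma slots_split k :
  (\sum_(j < d | j < k) f j + \sum_(j < d | k <= j) f j = n)%N.
Proof.
rewrite -[RHS]sum_f [RHS](bigID (fun j : 'I_d => j < k)%N) /=; congr addn.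
by apply: eq_bigl => j; rewrite -leqNgt.
Qed.

Lemma tail_le1 k : (n - 1 <= \sum_(j < d | j < k) f j)%N =
  (\sum_(j < d | (k <= j)%N) f j <= 1)%N.
Proof. by rewrite -[in LHS](slots_split k) leq_subLR [leqRHS]addnC leq_add2l. Qed.

(** Once [M] slots are resolved, at most one user is left, so that each further
    slot contributes a factor [z] and the sum telescopes.  The index [M] is
    specified by its order property alone: for [n >= 2] it is the stopping slot,
    while for [n < 2] the value [M = 0] accounts for the initial conditions. *)
Lemma stopped_prodE (K : comPzRingType) (a : nat -> K) (z : K) (M : nat) :
  a 0%N = z -> a 1%N = z -> (0 < d)%N -> (M <= d)%N ->
  (forall k, (M <= k)%N = (n - 1 <= \sum_(j < d | j < k) f j)%N) ->
  z ^+ (M < d)%N * \prod_(j < d | (j < M)%N) a (f j) =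
  \prod_(j < d) a (f j) +
  \sum_(0 <= k < d.-1 | (n - 1 <= \sum_(j < d | j < k) f j)%N)
     (z - z ^+ 2) * \prod_(j < d | (j < k)%N) a (f j).
Proof.
move=> a0 a1 d0 Md MP; pose A k := \prod_(j < d | (j < k)%N) a (f j).
have AS k : (M <= k < d)%N -> A k.+1 = A k * z.
  move=> /andP[Mk kd]; rewrite /A (bigD1 (Ordinal kd))//= mulrC; congr (_ * _).
    by apply: eq_bigl => j; rewrite -val_eqE /= ltnS ltn_neqAle andbC.
  have : (f (Ordinal kd) <= 1)%N.
    move: Mk; rewrite MP tail_le1; apply: leq_trans.
    by rewrite (bigD1 (Ordinal kd))//= leq_addr.
  by case: (f _) => [|[|]].
have Ad : \prod_(j < d) a (f j) = A d by apply: eq_bigl => j; rewrite ltn_ord.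
rewrite Ad; have [Md'|dM] := ltnP M d; last first.
  have -> : M = d by apply/eqP; rewrite eqn_leq Md.
  rewrite expr0 mul1r [X in _ + X]big_nat_cond.
  rewrite [X in _ + X]big1 ?addr0// => k /andP[/andP[_ kd]].
  by rewrite -MP leqNgt (leq_trans kd)// (leq_trans (leq_pred d)).
have Md1 : (M <= d.-1)%N by rewrite -ltnS prednK.
rewrite (big_cat_nat (n := M))//= [X in _ + (X + _)]big_nat_cond.
rewrite [X in _ + (X + _)]big1 ?add0r => [|k]; last first.
  by move=> /andP[/andP[_ kM]]; rewrite -MP leqNgt kM.
rewrite expr1 big_nat_cond.
rewrite (eq_big (fun k => M <= k < d.-1)%N (fun k => - (z * A k.+1 - z * A k))); first last.
- move=> k /andP[/andP[Mk kd] _]; rewrite AS ?Mk ?(leq_trans kd (leq_pred d))//.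
  by rewrite opprB mulrBl expr2 -mulrA [z * A k]mulrC !mulrA.
- by move=> k; case: (leqP M k) => //= Mk; rewrite -MP Mk andbT.
rewrite -big_nat sumrN telescope_sumr// opprB.
have -> : A d = A d.-1 * z.
  by rewrite -AS; [rewrite prednK | rewrite Md1 prednK /=].
by rewrite [_ * z]mulrC addrC subrK.
Qed.

End StoppingSlot.

(** * Polynomials attached to the slots *)

Lemma prod_slots_split {K : comPzSemiRingType} {d : nat} k (h : 'I_d -> K) :
  \prod_j h j = (\prod_(j < d | (j < k)%N) h j) * \prod_(j < d | (k <= j)%N) h j.
Proof.
rewrite (bigID (fun j : 'I_d => j < k)%N) /=; congr (_ * _).
by apply: eq_bigl => j; rewrite -leqNgt.
Qed.

Section SlotPolynomials.
Context {K : comNzRingType}.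

Lemma natr_prod_forall (I : finType) (Q b : pred I) :
  \prod_(j | Q j) (b j)%:R = ([forall (j | Q j), b j]%:R : K).
Proof.
have [/forall_inP bQ|] := boolP [forall (j | Q j), b j].
  by rewrite big1// => j /bQ ->.
rewrite negb_forall_in => /exists_inP[j Qj /negPf bj].
by rewrite (bigD1 j)//= bj mul0r.
Qed.

(** A tail holding at most one item in total is either empty or has a single
    item in a single place [i]. *)
Lemma prod_tail_le1 (I : finType) (Q : pred I) (w : I -> nat -> K) (f : I -> nat) :
  (forall j, w j 0%N = 1) ->
  (\sum_(j | Q j) f j <= 1)%N%:R * \prod_(j | Q j) w j (f j) =
  \prod_(j | Q j) (f j == 0%N)%:R +
  \sum_(i | Q i) w i 1%N * \prod_(j | Q j) (f j == (j == i))%:R.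
Proof.
move=> w0; rewrite natr_prod_forall.
under [X in _ + X]eq_bigr do rewrite natr_prod_forall.
have [/forall_inP f0|] := boolP [forall (j | Q j), f j == 0%N].
  rewrite big1 => [|j /f0/eqP//]; rewrite mul1r big1 => [|j /f0/eqP->//].
  rewrite big1 ?addr0// => i Qi; case: forall_inP => [/(_ _ Qi)|_]; last exact: mulr0.
  by rewrite eqxx (eqP (f0 i Qi)).
rewrite negb_forall_in => /exists_inP[i Qi fi]; rewrite add0r.
have [f1|f1] := leqP (\sum_(j | Q j) f j)%N 1; last first.
  rewrite mul0r big1// => j Qj; case: forall_inP => [fj|_]; last exact: mulr0.
  move: f1; rewrite (eq_bigr (fun k => (k == j) : nat)) => [|k /fj/eqP//].
  by rewrite (bigD1 j)//= eqxx big1 ?addn0// => k /andP[_ /negPf->].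
have f1i : f i = 1%N /\ (forall j, Q j -> j != i -> f j = 0%N).
  move: f1; rewrite (bigD1 i)//=; move: fi; case: (f i) => [|[|m]]//= _.
  rewrite ltnS leqn0 sum_nat_eq0 => /forallP h; split=> // j Qj ji.
  by move: (h j); rewrite Qj ji => /eqP.
rewrite mul1r (bigD1 i)//= f1i.1 [X in _ * X]big1 => [|j /andP[Qj ji]]; last first.
  by rewrite f1i.2// w0.
rewrite (bigD1 i)//= [X in _ + X]big1 ?addr0 => [|j /andP[Qj ji]].
  case: forall_inP => [//|h]; case: h => j Qj.
  by case: (eqVneq j i) => [->|ji]; rewrite ?f1i.1// f1i.2.
case: forall_inP => [/(_ i Qi)|_]; last exact: mulr0.
by rewrite f1i.1 [i == j]eq_sym (negPf ji).
Qed.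

Variables (d n : nat).
Implicit Types F : 'I_d -> nat -> K.

Lemma coef_prod_slots F m :
  (\prod_(j < d) \poly_(i < n.+1) F j i)`_m =
  \sum_(f : {ffun 'I_d -> 'I_n.+1} | (\sum_j f j == m)%N) \prod_j F j (f j).
Proof.
under eq_bigr do rewrite poly_def.
rewrite bigA_distr_bigA coef_sum [RHS]big_mkcond; apply: eq_bigr => f _.
rewrite scaler_prod coefZ -expr_sum coefXn [(m == _)]eq_sym.
by case: ifP; rewrite ?mulr1 ?mulr0.
Qed.

(** When at most one user remains after the first [k] slots, the remaining slots
    contribute [1] if there is none and the weight of a single user otherwise:
    hence the linear factor in front of the product over the first [k] slots. *)
Lemma sum_slots_tail_le1 (w : 'I_d -> nat -> K) (a : nat -> K) k :
  (forall j, w j 0%N = 1) ->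
  \sum_(f : {ffun 'I_d -> 'I_n.+1} | (\sum_j f j == n)%N)
    (\prod_j w j (f j)) *
    ((\sum_(j < d | (k <= j)%N) f j <= 1)%N%:R * \prod_(j < d | (j < k)%N) a (f j)) =
  ((1 + (\sum_(j < d | (k <= j)%N) w j 1%N) *: 'X) *
    \prod_(j < d | (j < k)%N) \poly_(i < n.+1) (w j i * a i))`_n.
Proof.
move=> w0.
(* [e] prescribes the contents of the slots from [k] on; it will be zero or the
   indicator of one slot. *)
pose G (e : 'I_d -> nat) (j : 'I_d) i : K :=
  if (j < k)%N then w j i * a i else (i == e j)%:R.
have prodG e (f : {ffun 'I_d -> 'I_n.+1}) : \prod_j G e j (f j) =
    (\prod_(j < d | (j < k)%N) (w j (f j) * a (f j))) *
    \prod_(j < d | (k <= j)%N) (f j == e j :> nat)%:R.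
  rewrite (prod_slots_split k); congr (_ * _); apply: eq_bigr => j jk.
    by rewrite /G jk.
  by rewrite /G ltnNge jk.
have polyG e : \prod_j \poly_(i < n.+1) G e j i =
    (\prod_(j < d | (j < k)%N) \poly_(i < n.+1) (w j i * a i)) *
    \prod_(j < d | (k <= j)%N) \poly_(i < n.+1) ((i == e j)%:R : K).
  rewrite (prod_slots_split k); congr (_ * _); apply: eq_bigr => j jk;
    apply: eq_poly => i _; first by rewrite /G jk.
  by rewrite /G ltnNge jk.
transitivity ((\prod_j \poly_(i < n.+1) G (fun=> 0%N) j i)`_n +
    \sum_(i < d | (k <= i)%N) w i 1%N *
      (\prod_j \poly_(m < n.+1) G (fun j => (j == i) : nat) j m)`_n).
  rewrite coef_prod_slots; under [X in _ + X]eq_bigr do rewrite coef_prod_slots mulr_sumr.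
  rewrite exchange_big -big_split /=; apply: eq_bigr => f _.
  rewrite prodG; under [X in _ + X]eq_bigr do rewrite prodG mulrCA.
  rewrite -mulr_sumr -mulrDr -prod_tail_le1// big_split /=.
  rewrite [in LHS](prod_slots_split k).
  by rewrite [X in _ * X]mulrC mulrACA [X in _ * X]mulrC.
set T := \prod_(j < d | (j < k)%N) _.
have poly0 : \poly_(i < n.+1) ((i == 0%N)%:R : K) = 1.
  apply/polyP => i; rewrite coef_poly coef1; case: ltnP => //.
  by case: i.
rewrite polyG -/T [X in T * X]big1 ?mulr1 => [|j _]; last exact: poly0.
rewrite mulrDl mul1r coefD; congr (_ + _).
rewrite -scalerAl coefZ mulr_suml; apply: eq_bigr => i ki; congr (_ * _).
rewrite polyG -/T (bigD1 i)//= eqxx.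
rewrite big1 ?mulr1 => [|j /andP[_ /negPf->]]; last exact: poly0.
(* For [n = 0] the truncation of ['X] is zero; the coefficient of ['X^0] in a
   multiple of ['X] is zero as well. *)
have [n0|n0] := posnP n.
  by rewrite poly_def n0 big_ord1 /= scale0r mulr0 coef0 coefXM.
suff -> : \poly_(m < n.+1) ((m == 1%N)%:R : K) = 'X by rewrite mulrC.
apply/polyP => m; rewrite coef_poly coefX; case: ltnP => //.
by case: m => [|[|m]] //; rewrite ltnS leqn0 => /eqP n00; rewrite n00 in n0.
Qed.

End SlotPolynomials.

(** * The identity between coefficients *)

Section CoefficientIdentity.
Context {R : realType} (d : nat) (p : 'I_d -> R).
Local Notation C := R[i].
Hypotheses (d0 : (0 < d)%N) (p1 : \sum_(j < d) p j = 1).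
Variables (x z : C) (a : nat -> C).
Hypotheses (a0 : a 0%N = z) (a1 : a 1%N = z).

Definition slot_weight (j : 'I_d) (i : nat) : C := (x * (p j)%:C) ^+ i / i`!%:R.

Lemma slot_weight0 j : slot_weight j 0%N = 1.
Proof. by rewrite /slot_weight expr0 fact0 divr1. Qed.

Lemma slot_weight1 j : slot_weight j 1%N = x * (p j)%:C.
Proof. by rewrite /slot_weight expr1 divr1. Qed.

(** The factor [1 / n!] of the exponential generating function turns the
    multinomial distribution into a product over the slots. *)
Lemma multinomial_weight n (f : 'I_d -> nat) : (\sum_j f j = n)%N ->
  x ^+ n / n`!%:R * (multinomial_pmf p n f)%:C = \prod_j slot_weight j (f j).
Proof.
move=> fn; rewrite /multinomial_pmf fn eqxx.
rewrite /slot_weight big_split /= (eq_bigr _ (fun j _ => exprMn _ _ _)) big_split /=.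
rewrite prodrXr fn rmorphM fmorph_div !rmorph_nat natr_prod rmorph_prod.
rewrite -!mulrA; congr (_ * _); rewrite mulKf ?pnatr_eq0 -?lt0n ?fact_gt0//.
rewrite mulrC prodfV; congr (_ * _).
by apply: eq_bigr => j _; rewrite rmorphXn.
Qed.

(** The multinomial theorem for [n < 2], as the case [k = 0] of
    [sum_slots_tail_le1], in which the tail consists of all slots. *)
Lemma sum_slot_weight n : (n < 2)%N ->
  \sum_(f : {ffun 'I_d -> 'I_n.+1} | (\sum_j f j == n)%N) \prod_j slot_weight j (f j) =
  x ^+ n / n`!%:R.
Proof.
move=> n2; have := sum_slots_tail_le1 d n slot_weight (fun=> 1) 0 slot_weight0.
have -> : \prod_(j < d | (j < 0)%N) \poly_(i < n.+1) (slot_weight j i * 1) = 1.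
  exact: big_pred0.
rewrite mulr1 coefD coef1 coefZ coefX => tail_le1_sum.
rewrite (eq_bigr (fun f : {ffun 'I_d -> 'I_n.+1} => (\prod_j slot_weight j (f j)) *
    ((\sum_(j < d | (0 <= j)%N) f j <= 1)%N%:R *
    \prod_(j < d | (j < 0)%N) 1))) => [|f /eqP fn]; last first.
  by rewrite big1_eq fn -ltnS n2 !mulr1.
rewrite tail_le1_sum; under eq_bigr do rewrite slot_weight1.
rewrite -mulr_sumr -rmorph_sum p1 mulr1.
by case: n n2 {tail_le1_sum} => [|[|]]// _; rewrite ?mulr0 ?mulr1 ?addr0 ?add0r ?divr1.
Qed.

Hypothesis a_rec : forall n, (2 <= n)%N ->
  a n = \sum_(f : {ffun 'I_d -> 'I_n.+1}) (multinomial_pmf p n (fun j => f j))%:C *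
    (z ^+ (stop_slot n (fun j => f j) < d)%N *
     \prod_(j < d | (j < stop_slot n (fun j => f j))%N) a (f j)).

(** The recursion is rewritten so that it no longer refers to the stopping slot,
    and so that it also covers the initial values [n < 2]. *)
Lemma weighted_recursion n :
  x ^+ n / n`!%:R * a n =
  \sum_(f : {ffun 'I_d -> 'I_n.+1} | (\sum_j f j == n)%N)
    (\prod_j slot_weight j (f j)) *
    (\prod_j a (f j) +
     \sum_(0 <= k < d.-1 | (n - 1 <= \sum_(j < d | j < k) f j)%N)
       (z - z ^+ 2) * \prod_(j < d | (j < k)%N) a (f j)).
Proof.
have [n2|n2] := ltnP n 2.
  have -> : a n = z by case: n n2 => [|[|]].
  rewrite -sum_slot_weight// mulr_suml; apply: eq_bigr => f /eqP fn.
  rewrite -(@stopped_prodE d n (fun j => f j) fn _ a z 0)//.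
    by rewrite d0 expr1; congr (_ * _); rewrite big_pred0 ?mulr1.
  by move=> k; have /eqP -> : (n - 1 == 0)%N by rewrite subn_eq0 -ltnS.
rewrite a_rec// mulr_sumr [RHS]big_mkcond; apply: eq_bigr => f _.
case: eqP => fn; last by rewrite /multinomial_pmf (introF eqP fn) mul0r mulr0.
rewrite mulrA multinomial_weight//.
rewrite -(@stopped_prodE d n (fun j => f j) fn _ a z (stop_slot n (fun j => f j)))//.
- exact: stop_slot_le.
- by move=> k; exact: stop_slotP.
Qed.

(** The functional equation at the level of the coefficients of [x ^+ n]; the
    condition that at most one user is left after [k] slots produces the linear
    factor [1 + Fbar p k * x]. *)
Lemma coefficient_identity n :
  x ^+ n / n`!%:R * a n =
  (\prod_(j < d) \poly_(i < n.+1) (slot_weight j i * a i))`_n +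
  \sum_(0 <= k < d.-1) (z - z ^+ 2) *
    ((1 + ((Fbar p k)%:C * x) *: 'X) *
     \prod_(j < d | (j < k)%N) \poly_(i < n.+1) (slot_weight j i * a i))`_n.
Proof.
rewrite weighted_recursion; under eq_bigr do rewrite mulrDr -big_split /=.
rewrite big_split coef_prod_slots /=; congr (_ + _).
under eq_bigr do rewrite mulr_sumr.
under eq_bigr do rewrite big_mkcond.
rewrite exchange_big /=; apply: eq_bigr => k _.
have <- : \sum_(j < d | (k <= j)%N) slot_weight j 1 = (Fbar p k)%:C * x.
  under eq_bigr do rewrite slot_weight1.
  by rewrite -mulr_sumr mulrC -rmorph_sum.
rewrite -sum_slots_tail_le1; last exact: slot_weight0.
rewrite mulr_sumr; apply: eq_bigr => f /eqP fn; rewrite (@tail_le1 d n (fun j => f j) fn).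
by case: ifP => _; rewrite ?mul1r ?mul0r ?mulr0// mulrCA.
Qed.

End CoefficientIdentity.

(** * Discrete random variables *)

Section DiscreteVariables.
Context {R : realType} {dT : measure_display} {T : measurableType dT}.
Variable P : probability T R.
Local Open Scope classical_set_scope.
Local Open Scope ereal_scope.

Lemma measurable_eq d' (S : measurableType d') (X : {RV P >-> S}) (v : S) :
  measurable [set v] -> measurable [set w | X w = v].
Proof.
by move=> mv; rewrite -[X in measurable X]/(X @^-1` [set v]); exact: measurable_funPTI.
Qed.

Lemma measurable_enat (X : {RV P >-> enat}) v : measurable [set w | X w = v].
Proof. exact: measurable_eq. Qed.

Lemma measurable_nat (X : {RV P >-> nat}) v : measurable [set w | X w = v].
Proof. exact: measurable_eq. Qed.

Lemma measurable_forall (I : finType) (A : I -> set T) :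
  (forall i, measurable (A i)) -> measurable [set w | forall i, A i w].
Proof.
move=> mA; have -> : [set w | forall i, A i w] = \bigcap_(i in [set: I]) A i.
  by apply/seteqP; split => [w h i _|w h i]; exact: h.
exact: fin_bigcap_measurable.
Qed.

Lemma measure_ae_eq (A B : set T) : measurable A -> measurable B ->
  {ae P, forall w, A w <-> B w} -> P A = P B.
Proof.
move=> mA mB AB.
have le (A' B' : set T) : measurable A' -> measurable B' ->
    {ae P, forall w, A' w <-> B' w} -> P A' <= P B'.
  move=> mA' mB' [N [mN N0 ABN]]; rewrite -[leRHS]adde0 -[X in _ + X]N0.
  apply: le_trans (measureU2 _ mB' mN); apply: le_measure; rewrite ?inE//.
    exact: measurableU.
  move=> w Aw; have [Bw|Bw] := pselect (B' w); [by left|right].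
  by apply: ABN => /= h; exact/Bw/h.
apply/eqP; rewrite eq_le !le//.
by apply: filterS AB => w [? ?]; split.
Qed.

Lemma measure_fin_partition (I : finType) (F : I -> set T) :
  (forall i, measurable (F i)) -> (forall i j w, F i w -> F j w -> i = j) ->
  P [set w | exists i, F i w] = \sum_i P (F i).
Proof.
move=> mF dF; pose U (r : seq I) := [set w | exists2 i, i \in r & F i w].
suff /(_ (index_enum I) (index_enum_uniq I))[_ <-] : forall r, uniq r ->
    measurable (U r) /\ P (U r) = \sum_(i <- r) P (F i).
  congr (P _); apply/seteqP; split=> [w [j Fj]|w [j _ Fj]]; last by exists j.
  by exists j => //; exact: mem_index_enum.
elim=> [_|i r IH /= /andP[ir /IH[mU PU]]].
  have -> : U [::] = set0 by apply/seteqP; split=> [w [j]|w []].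
  by rewrite big_nil measure0.
have -> : U (i :: r) = F i `|` U r.
  apply/seteqP; split => [w [j]|w [Fi|[j jr Fj]]].
  - by rewrite inE => /orP[/eqP ->|jr Fj]; [left|right; exists j].
  - by exists i; rewrite ?mem_head.
  - by exists j; rewrite // inE jr orbT.
split; first exact: measurableU.
rewrite big_cons -PU; apply: measureU => //.
rewrite -subset0 => w [Fi [j jr Fj]].
by move: ir; rewrite (dF _ _ _ Fi Fj) jr.
Qed.

Definition enat_enum (k : nat) : enat := if k is k'.+1 then Some k' else None.

Lemma measure_enat_partition (X : {RV P >-> enat}) (A : set T) : measurable A ->
  \sum_(k <oo) P (A `&` [set w | X w = enat_enum k]) = P A.
Proof.
move=> mA.
have enum_inj k k' : enat_enum k = enat_enum k' -> k = k'.
  by case: k k' => [|k] [|k'] //= [->].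
transitivity (P (\bigcup_k (A `&` [set w | X w = enat_enum k]))).
  rewrite measure_bigcup.
  - by apply: eq_eseriesl => k; rewrite in_setT.
  - by move=> k _; apply: measurableI => //; exact: measurable_enat.
  - apply/trivIsetP => i j _ _ /eqP ij; rewrite -subset0 => w [[_ /= Xi] [_ /= Xj]].
    by apply: ij; apply: enum_inj; rewrite -Xi.
congr (P _); apply/seteqP; split => [w [k _ []]//|w Aw].
by case Xw : (X w) => [k|]; [exists k.+1|exists 0%N].
Qed.

Definition mass (X : {RV P >-> enat}) (k : nat) : R := fine (P [set w | X w = Some k]).

Lemma massE (X : {RV P >-> enat}) k : P [set w | X w = Some k] = (mass X k)%:E.
Proof. by rewrite /mass fineK// fin_num_measure//; exact: measurable_enat. Qed.

Lemma mass_ge0 (X : {RV P >-> enat}) k : (0 <= mass X k)%R.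
Proof. exact: fine_ge0. Qed.

(** As [h] vanishes at infinity, only the finite values of [X] contribute, so the
    sum runs over the natural numbers even if [X] is infinite with positive
    probability. *)
Lemma expectation_mass (X : {RV P >-> enat}) (h : enat -> R) :
  h None = 0%R -> P.-integrable setT (fun w => (h (X w))%:E) ->
  cvgn (series (fun k => `|h (Some k)| * mass X k)%R) /\
  (series (fun k => h (Some k) * mass X k)%R @ \oo --> fine 'E_P[fun w => h (X w)]).
Proof.
move=> h0 hX; pose F k := [set w | X w = Some k].
have mF k : measurable (F k) by exact: measurable_enat.
have tF : trivIset setT F.
  apply/trivIsetP => i j _ _ /eqP ij; rewrite -subset0 => w [].
  by rewrite /F /= => -> [].
have int_mass (h' : enat -> R) k :
    \int[P]_(w in F k) (h' (X w))%:E = (h' (Some k) * mass X k)%:E.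
  rewrite (eq_integral (cst (h' (Some k))%:E)) => [|w]; last by rewrite inE => ->.
  by rewrite integral_cst// EFinM; congr (_ * _); exact: massE.
have off_F (h' : enat -> R) : h' None = 0%R ->
    \int[P]_w (h' (X w))%:E = \int[P]_(w in \bigcup_k F k) (h' (X w))%:E.
  move=> h'0; rewrite [RHS]integral_mkcond; apply: eq_integral => w _.
  rewrite patchE; case: ifPn => //; rewrite notin_setE => nF.
  case Xw : (X w) => [k|]; last by rewrite h'0.
  by case: nF; exists k.
have [mh hfin] := integrableP _ _ _ hX.
have cabs : cvgn (series (fun k => `|h (Some k)| * mass X k)%R).
  pose s := \int[P]_w (`|h (X w)|)%:E.
  have sE : s = \sum_(k <oo) (`|h (Some k)| * mass X k)%:E.
    rewrite /s (off_F (fun v => `|h v|%R)) ?h0 ?normr0// ge0_integral_bigcup//.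
      by apply: eq_eseriesr => k _; exact: (int_mass (fun v => `|h v|%R)).
    apply: (measurable_funS _ (@subsetT _ _)) => //.
    exact: (measurableT_comp (@abse_measurable R setT) mh).
  have sfin : s \is a fin_num.
    rewrite ge0_fin_numE; first exact: hfin.
    by apply: integral_ge0 => w _; rewrite lee_fin.
  apply: nondecreasing_is_cvgn.
    by apply: nondecreasing_series => k _ _; rewrite mulr_ge0// mass_ge0.
  exists (fine s) => _ [n _ <-]; rewrite -lee_fin fineK// sE /series /= -sumEFin.
  by apply: nneseries_lim_ge => k _ _; rewrite lee_fin mulr_ge0// mass_ge0.
split=> //.
have cser : cvgn (series (fun k => h (Some k) * mass X k)%R).
  apply: normed_cvg; rewrite /normed_series_of.
  by under eq_fun do rewrite normrM (ger0_norm (mass_ge0 _ _)).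
suff -> : fine 'E_P[fun w => h (X w)] =
  limn (series (fun k => h (Some k) * mass X k)%R) by [].
rewrite unlock off_F// integral_bigcup//; last first.
  by apply: (integrableS measurableT) => //; exact: bigcupT_measurable.
under eq_eseriesr do rewrite int_mass.
rewrite -[RHS]/(fine (limn _)%:E) -EFin_lim//; congr (fine (limn _)).
by apply/funext => n; rewrite /series /= -sumEFin.
Qed.

End DiscreteVariables.

(** * The law of the interval lengths *)

Section EnatSums.
Variable J : finType.

Lemma enat_sum_Some (Q : pred J) (a : J -> enat) (u : J -> nat) :
  (forall j, Q j -> a j = Some (u j)) ->
  \big[enat_add/Some 0%N]_(j | Q j) a j = Some (\sum_(j | Q j) u j)%N.
Proof.
move=> au; apply/esym; rewrite (eq_bigr _ au).
by elim/big_rec2: _ => // j x y Qj <-.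
Qed.

Lemma enat_sum_SomeP (Q : pred J) (a : J -> enat) (m : nat) :
  \big[enat_add/Some 0%N]_(j | Q j) a j = Some m ->
  (forall j, Q j -> a j = Some (odflt 0%N (a j))) /\
  (\sum_(j | Q j) odflt 0%N (a j) = m)%N.
Proof.
move=> am; have aS j : Q j -> a j = Some (odflt 0%N (a j)).
  move=> Qj; move: am; rewrite (bigD1 j)//=.
  by case: (a j).
by split=> //; move: am; rewrite (enat_sum_Some _ _ _ aS) => -[].
Qed.

End EnatSums.

Section RecursionForTheLaw.
Context {R : realType} {dT : measure_display} {T : measurableType dT}.
Context {P : probability T R} {d : nat} {p : 'I_d -> R}.
Context {l : nat -> {RV P >-> enat}}.
Context {I : nat -> 'I_d -> {RV P >-> nat}} {L : nat -> 'I_d -> {RV P >-> enat}}.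
Hypothesis hl : sicta_recursion p l I L.
Local Open Scope classical_set_scope.

Lemma measurable_slots n (i : 'I_d -> nat) : measurable [set w | forall j, I n j w = i j].
Proof. by apply: measurable_forall => j; exact: measurable_nat. Qed.

Lemma measurable_slots_lengths n (i : 'I_d -> nat) (Q : pred 'I_d) (v : 'I_d -> enat) :
  measurable ([set w | forall j, I n j w = i j] `&`
              [set w | forall j, Q j -> L n j w = v j]).
Proof.
apply: measurableI; first exact: measurable_slots.
apply: (measurable_forall _ (fun j => [set w | Q j -> L n j w = v j])) => j.
case: (Q j); last by rewrite (_ : [set w | _] = setT)//; apply/seteqP; split.
rewrite (_ : [set w | _] = [set w | L n j w = v j]); first exact: measurable_enat.
by apply/seteqP; split => w h //=; exact: h.
Qed.

(** The recursion reads the lengths of the first [M] slots only, so the other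
    ones have to be summed out of the joint law; this is done one slot at a time,
    by countable additivity over the values of its length. *)
Lemma marginal_law n (i : 'I_d -> nat) (Q : pred 'I_d) (v : 'I_d -> enat) :
  (2 <= n)%N ->
  P ([set w | forall j, I n j w = i j] `&`
     [set w | forall j, Q j -> L n j w = v j]) =
  (multinomial_pmf p n i * \prod_(j < d | Q j) fine (P [set w | l (i j) w = v j]))%:E.
Proof.
move=> n2; move: v; have [m] := ubnP #|predC Q|; elim: m Q => // m IH Q Qm v.
have [[j0 Qj0]|allQ] := pselect (exists j0, ~~ Q j0); last first.
  have {}allQ j : Q j by apply/negPn/negP => nQ; apply: allQ; exists j.
  have -> : [set w | forall j, Q j -> L n j w = v j] = [set w | forall j, L n j w = v j].
    by apply/seteqP; split => w h j; [exact: h|move=> _; exact: h].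
  rewrite (sicta_cond_indep hl n2) (sicta_multinomial hl n2) EFinM -prodEFin.
  congr (_ * _)%E; apply: eq_big => j; first by rewrite allQ.
  by move=> _; rewrite fineK// fin_num_measure//; exact: measurable_enat.
pose v' k j := if j == j0 then enat_enum k else v j.
rewrite -(measure_enat_partition P (L n j0)); last exact: measurable_slots_lengths.
under eq_eseriesr => k _.
  rewrite -setIA (_ : _ `&` [set w | L n j0 w = _] =
      [set w | forall j, Q j || (j == j0) -> L n j w = v' k j]); last first.
    apply/seteqP; split => [w [Qv Lj0] j|w h].
      by rewrite /v'; case: eqVneq => [->//|_]; rewrite orbF; exact: Qv.
    split=> [j Qj|].
      have := h j; rewrite Qj /v'; case: eqVneq => [jj0|_]; last exact.
      by move: Qj0; rewrite -jj0 Qj.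
    by have := h j0; rewrite eqxx orbT /v' eqxx; exact.
  rewrite IH; last first.
    rewrite ltnS in Qm; apply: leq_trans Qm; apply: proper_card; apply/properP; split.
      by apply/fintype.subsetP => j; rewrite !inE negb_or => /andP[].
    by exists j0; rewrite !inE// eqxx orbT.
  rewrite (bigD1 j0) /=; last by rewrite eqxx orbT.
  rewrite (eq_big Q (fun j => fine (P [set w | l (i j) w = v j]))); first last.
  - by move=> j /andP[_ /negPf]; rewrite /v' => ->.
  - move=> j; case: eqVneq => [->|_]; last by rewrite orbF andbT.
    by rewrite andbF (negPf Qj0).
  rewrite {1}/v' eqxx mulrCA mulrC EFinM fineK; last first.
    by rewrite fin_num_measure//; exact: measurable_enat.
  over.
rewrite nneseriesZl; last by move=> k _; exact: measure_ge0.
have := measure_enat_partition P (l (i j0)) setT measurableT.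
under eq_eseriesr do rewrite setTI.
by move=> ->; rewrite probability_setT mule1.
Qed.

(** Vectors that do not sum to [n] have multinomial mass zero, and there are
    countably many of them. *)
Lemma slots_sum_ae n : (2 <= n)%N ->
  {ae P, forall w, (\sum_(j < d) I n j w = n)%N}.
Proof.
move=> n2.
pose N m : set T := if @unpickle {ffun 'I_d -> nat} m is Some i then
  (if (\sum_j i j == n)%N then set0 else [set w | forall j, I n j w = i j]) else set0.
have N0 m : P.-negligible (N m).
  rewrite /N; case: unpickle => [i|]; last exact: negligible_set0.
  case: ifPn => in_; first exact: negligible_set0.
  apply/negligibleP; first exact: measurable_slots.
  apply: etrans (sicta_multinomial hl n2 (fun j => i j)) _.
  by rewrite /multinomial_pmf (negPf in_).
apply: negligibleS (negligible_bigcup N0) => w /= Iw.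
pose i := [ffun j => I n j w].
exists (pickle i) => //; rewrite /N pickleK ifF; first by move=> j; rewrite ffunE.
apply/negP => /eqP iN; apply: Iw; apply: etrans iN.
by apply: eq_bigr => j _; rewrite ffunE.
Qed.

(** The mass at [k] of the stopped sum [1{M < d} + l_(f_1) + ... + l_(f_M)] with
    independent summands.  The slots after [M] carry the unit mass at zero, which
    makes [u] range over vectors indexed by all slots whatever [M] is. *)
Definition stopped_length_mass n k (f : 'I_d -> nat) : R :=
  \sum_(u : {ffun 'I_d -> 'I_k.+1} | ((stop_slot n f < d)%N + \sum_j u j == k)%N)
     \prod_(j < d) (if (j < stop_slot n f)%N then mass P (l (f j)) (u j)
              else (u j == 0 :> nat)%:R).

(** Up to a null set, the event that [l n] equals [k] is cut into finitely many
    pieces, indexed by the occupation numbers [f] and by the lengths [u] of the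
    slots up to [M]; the entries of [u] after [M] are set to zero, so that the
    pieces are disjoint. *)
Lemma law_recursion n k : (2 <= n)%N ->
  mass P (l n) k =
  \sum_(f : {ffun 'I_d -> 'I_n.+1})
    multinomial_pmf p n (fun j => f j) * stopped_length_mass n k (fun j => f j).
Proof.
move=> n2.
pose M (f : {ffun 'I_d -> 'I_n.+1}) := stop_slot n (fun j => f j).
pose ok (f : {ffun 'I_d -> 'I_n.+1}) (u : {ffun 'I_d -> 'I_k.+1}) :=
  ((M f < d)%N + \sum_j u j == k)%N &&
  [forall (j : 'I_d | (M f <= j)%N), u j == 0 :> nat].
pose B (a : {ffun 'I_d -> 'I_n.+1} * {ffun 'I_d -> 'I_k.+1}) : set T :=
  if ok a.1 a.2 then
    [set w | forall j, I n j w = a.1 j] `&`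
    [set w | forall j : 'I_d, (j < M a.1)%N -> L n j w = Some (a.2 j : nat)]
  else set0.
have mB a : measurable (B a).
  rewrite /B; case: ifP => // _.
  exact: (measurable_slots_lengths n _ (fun j => (j < _)%N)).
have PB a : P (B a) = (multinomial_pmf p n (fun j => a.1 j) *
   (((M a.1 < d)%N + \sum_j a.2 j == k)%N%:R *
    \prod_(j < d) (if (j < M a.1)%N then mass P (l (a.1 j)) (a.2 j)
                   else (a.2 j == 0 :> nat)%:R)))%:E.
  rewrite /B /ok; case: eqP => ak /=; last by rewrite measure0 mul0r mulr0.
  rewrite mul1r (prod_slots_split (M a.1)) /=.
  rewrite [X in _ * (_ * X)](eq_bigr (fun j => (a.2 j == 0 :> nat)%:R)); last first.
    by move=> j Mj; rewrite ltnNge Mj.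
  rewrite natr_prod_forall; case: ifP => _; last by rewrite measure0 !mulr0.
  rewrite (marginal_law n _ (fun j => (j < M a.1)%N) (fun j => Some (a.2 j : nat)) n2).
  rewrite mulr1.
  by congr (_ * _)%:E; apply: eq_bigr => j ->.
have dB a b w : B a w -> B b w -> a = b.
  case: a b => [f u] [f' u']; rewrite /B /ok /=.
  case: ifPn => // /andP[_ /forall_inP u0]; case: ifPn => // /andP[_ /forall_inP u0'].
  move=> [/= If Lu] [/= If' Lu'].
  have ff' : f = f' by apply/ffunP => j; apply: val_inj; rewrite /= -If -If'.
  subst f'; congr (_, _); apply/ffunP => j; apply: val_inj => /=.
  have [jM|Mj] := ltnP j (M f); last by rewrite (eqP (u0 j Mj)) (eqP (u0' j Mj)).
  by have := Lu j jM; rewrite (Lu' j jM) => -[].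
have lB : {ae P, forall w, l n w = Some k <-> exists a, B a w}.
  have := sicta_step hl n2; have := slots_sum_ae n n2.
  apply: filterS2 => w sumI ->; rewrite /sicta_rhs; split; last first.
    move=> [[f u]]; rewrite /B /ok /=.
    case: ifPn => // /andP[/eqP uk /forall_inP u0] [/= If Lu].
    have -> : (fun j => I n j w) = (fun j => f j : nat) by apply/funext => j.
    rewrite -/(M f) (enat_sum_Some _ (fun j : 'I_d => j < M f)%N _ (fun j => u j : nat))//=.
    rewrite -[in RHS]uk; congr (Some (addn _ _)).
    rewrite [RHS](bigID (fun j : 'I_d => j < M f)%N) /= [X in (_ + X)%N]big1 ?addn0//.
    by move=> j; rewrite -leqNgt => /u0/eqP.
  pose f : {ffun 'I_d -> 'I_n.+1} := [ffun j => inord (I n j w)].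
  have fE j : f j = I n j w :> nat.
    by rewrite ffunE inordK// ltnS -[leqRHS]sumI (bigD1 j)//= leq_addr.
  have -> : (fun j => I n j w) = (fun j => f j : nat) by apply/funext => j.
  rewrite -/(M f); case E : (\big[_/_]_(j | _) _) => [m|]//= [mk].
  have [LS Lm] := enat_sum_SomeP _ _ _ _ E.
  pose u : {ffun 'I_d -> 'I_k.+1} :=
    [ffun j : 'I_d => if (j < M f)%N then inord (odflt 0%N (L n j w)) else ord0].
  have uE (j : 'I_d) : u j = (if (j < M f)%N then odflt 0%N (L n j w) else 0%N) :> nat.
    rewrite ffunE; case: ifPn => // jM; rewrite inordK// ltnS -mk -Lm.
    by rewrite (bigD1 j)//= addnCA leq_addr.
  exists (f, u); rewrite /B /ok /= ifT.
    by split=> j //= jM; rewrite (LS j jM) uE jM.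
  apply/andP; split; last by apply/forall_inP => j Mj; rewrite uE ltnNge Mj.
  apply/eqP; apply: etrans mk; congr addn; apply: etrans Lm.
  by rewrite [RHS]big_mkcond; apply: eq_bigr => j _; rewrite uE.
rewrite /mass (measure_ae_eq P [set w | l n w = Some k] [set w | exists a, B a w] _ _ lB);
  first last.
- rewrite (_ : [set w | exists a, B a w] = \bigcup_(a in [set: _]) B a).
    by apply: fin_bigcup_measurable.
  by apply/seteqP; split => w [a]; exists a.
- exact: measurable_enat.
rewrite (measure_fin_partition P _ _ mB dB); under eq_bigr do rewrite PB.
rewrite sumEFin /=.
rewrite -(pair_bigA _ (fun (f : {ffun 'I_d -> 'I_n.+1}) (u : {ffun 'I_d -> 'I_k.+1}) =>
  multinomial_pmf p n (fun j => f j) *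
  (((M f < d)%N + \sum_j u j == k)%N%:R *
    \prod_(j < d) (if (j < M f)%N then mass P (l (f j)) (u j)
                   else (u j == 0 :> nat)%:R)))) /=.
apply: eq_bigr => f _; rewrite -mulr_sumr; congr (_ * _).
rewrite /stopped_length_mass [RHS]big_mkcond; apply: eq_bigr => u _.
by case: ifP => _; rewrite ?mul1r ?mul0r.
Qed.

End RecursionForTheLaw.

(** * Generating functions *)

Section GeneratingFunctions.
Context {R : realType} {dT : measure_display} {T : measurableType dT}.
Variable P : probability T R.
Local Notation C := R[i].
Local Open Scope classical_set_scope.

Definition pgf (X : {RV P >-> enat}) (z : C) : C :=
  complex_expectation P (fun w => epow z (X w)).

Lemma pgf_abs_sum (X : {RV P >-> enat}) (z : C) :
  complex_integrable P (fun w => epow z (X w)) ->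
  abs_sum (fun k => (mass P X k)%:C * z ^+ k) (pgf X z).
Proof.
move=> [iRe iIm].
have [cRe lRe] := expectation_mass P X (fun v => complex.Re (epow z v)) erefl iRe.
have [cIm lIm] := expectation_mass P X (fun v => complex.Im (epow z v)) erefl iIm.
split; last first.
  apply: cvg_complex.
    under eq_cvg do rewrite /series /= Re_sum.
    rewrite (_ : (fun n => _) =
        series (fun k => complex.Re (epow z (Some k)) * mass P X k)) //.
    apply/funext => n; apply: eq_bigr => k _ /=.
    by case: (z ^+ k) => a b /=; rewrite mul0r subr0 mulrC.
  under eq_cvg do rewrite /series /= Im_sum.
  rewrite (_ : (fun n => _) =
      series (fun k => complex.Im (epow z (Some k)) * mass P X k)) //.
  apply/funext => n; apply: eq_bigr => k _ /=.
  by case: (z ^+ k) => a b /=; rewrite mul0r addr0 mulrC.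
apply: (abs_sum_le _ ((fun k => `|complex.Re (epow z (Some k))| * mass P X k) +
    (fun k => `|complex.Im (epow z (Some k))| * mass P X k))).
  move=> k; rewrite cmodM cmod_real ger0_norm ?mass_ge0// mulrC fctE -mulrDl.
  by rewrite ler_wpM2r ?mass_ge0// cmod_le_ReIm.
by rewrite seriesD; exact: is_cvgD.
Qed.

Lemma mass_ae_const (X : {RV P >-> enat}) m k :
  {ae P, forall w, X w = Some m} -> mass P X k = (k == m)%:R.
Proof.
move=> Xm; rewrite /mass; case: eqVneq => [->|km].
  rewrite (measure_ae_eq P _ setT) ?probability_setT//; first exact: measurable_enat.
  by apply: filterS Xm.
rewrite (measure_ae_eq P _ set0) ?measure0//; first exact: measurable_enat.
apply: filterS Xm => w Xw; split=> //= Xk; move: Xw; rewrite Xk => -[mk].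
by rewrite mk eqxx in km.
Qed.

Lemma pgf_ae_one (X : {RV P >-> enat}) (z : C) :
  complex_integrable P (fun w => epow z (X w)) ->
  {ae P, forall w, X w = Some 1%N} -> pgf X z = z.
Proof.
move=> iX X1; apply: abs_sum_unique (pgf_abs_sum X z iX) _.
have sumE : \sum_(0 <= k < 2) (mass P X k)%:C * z ^+ k = z.
  rewrite big_nat_recr//= big_nat1 !(mass_ae_const X 1 _ X1) /=.
  by rewrite mul0r add0r mul1r expr1.
rewrite -[X in abs_sum _ X]sumE.
apply: (abs_sum_finite (fun k => (mass P X k)%:C * z ^+ k)) => -[|[|k]]// _.
by rewrite (mass_ae_const X 1 _ X1) mul0r.
Qed.

(** The generating function is a series with nonnegative terms at [r > 0]. *)
Lemma pgf_eq0_mass (X : {RV P >-> enat}) (r : R) : 0 < r ->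
  complex_integrable P (fun w => epow r%:C (X w)) ->
  pgf X r%:C = 0 -> forall k, mass P X k = 0.
Proof.
move=> r0 iX X0 k.
have [cs _] := pgf_abs_sum X _ iX.
have [_ ls] := expectation_mass P X (fun v => complex.Re (epow r%:C v)) erefl iX.1.
pose u k := complex.Re (epow r%:C (Some k)) * mass P X k.
have uE j : u j = r ^+ j * mass P X j by rewrite /u /= -rmorphXn.
have u0 j : 0 <= u j by rewrite uE mulr_ge0 ?mass_ge0// exprn_ge0// ltW.
have nu : nondecreasing_seq (series u) by exact: nondecreasing_series.
have lim0 : limn (series u) = 0.
  have <- : complex.Re (pgf X r%:C) = 0 by rewrite X0.
  exact: cvg_lim ls.
have : series u k.+1 <= 0.
  by rewrite -lim0; apply: nondecreasing_cvgn_le nu (cvgP _ ls) _.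
rewrite /series /= big_nat_recr//= => uk.
have uk0 : u k = 0.
  apply/eqP; rewrite eq_le u0 andbT; apply: le_trans uk; rewrite lerDr.
  by apply: sumr_ge0 => j _.
by move/eqP: uk0; rewrite uE mulf_eq0 expf_eq0 (gt_eqF r0) andbF => /eqP.
Qed.

Section UnitDisc.
Variables (X : {RV P >-> enat}) (h : enat -> R).
Hypothesis h1 : forall v, `|h v| <= 1.

Lemma measurable_enat_fun : measurable_fun setT (fun w => (h (X w))%:E).
Proof.
rewrite (_ : (fun w => _) = (fun v => (h v)%:E) \o X)//.
exact: measurableT_comp.
Qed.

Lemma integrable_bounded : P.-integrable setT (fun w => (h (X w))%:E).
Proof.
apply: (@le_integrable _ _ _ P _ measurableT _ (EFin \o cst 1)).
- exact: measurable_enat_fun.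
- by move=> w _ /=; rewrite lee_fin normr1.
- exact: finite_measure_integrable_cst.
Qed.

Lemma expectation_bounded : `|fine 'E_P[fun w => h (X w)]| <= 1.
Proof.
have iX := integrable_bounded.
have ifin := integrable_fin_num measurableT iX.
rewrite unlock -fine_abse// -lee_fin fineK ?abse_fin_num//.
apply: le_trans (le_abse_integral _ measurableT measurable_enat_fun) _.
rewrite -[leRHS](mule1) -(probability_setT P) -integral_cst//.
apply: ge0_le_integral => //.
- exact: (measurableT_comp (@abse_measurable R setT) measurable_enat_fun).
- by move=> w _ /=; rewrite probability_setT lee_fin.
Qed.

End UnitDisc.

Lemma epow_le1 (z : C) v : `|z| <= 1 -> cmod (epow z v) <= 1.
Proof.
rewrite cmodE -[1]/(1%:C) lecR => z1; case: v => [k|]; last by rewrite cmod0.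
by rewrite /= cmodX exprn_ile1// cmod_ge0.
Qed.

Lemma epow_integrable (X : {RV P >-> enat}) (z : C) : `|z| <= 1 ->
  complex_integrable P (fun w => epow z (X w)).
Proof.
move=> z1; split.
  apply: (integrable_bounded X (fun v => complex.Re (epow z v))) => v.
  exact: le_trans (Re_le_cmod _) (epow_le1 z v z1).
apply: (integrable_bounded X (fun v => complex.Im (epow z v))) => v.
exact: le_trans (Im_le_cmod _) (epow_le1 z v z1).
Qed.

Lemma cmod_pgf_le2 (X : {RV P >-> enat}) (z : C) : `|z| <= 1 -> cmod (pgf X z) <= 2.
Proof.
move=> z1; apply: le_trans (cmod_le_ReIm _) _; rewrite -[2]/(1 + 1) lerD//.
  apply: (expectation_bounded X (fun v => complex.Re (epow z v))) => v.
  exact: le_trans (Re_le_cmod _) (epow_le1 z v z1).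
apply: (expectation_bounded X (fun v => complex.Im (epow z v))) => v.
exact: le_trans (Im_le_cmod _) (epow_le1 z v z1).
Qed.

(** On the closed unit disc the expectations are bounded, so that the series is
    dominated by an exponential series. *)
Lemma Qtilde_defined_unit_disc (l : nat -> {RV P >-> enat}) (x z : C) :
  `|z| <= 1 -> Qtilde_defined l x z.
Proof.
move=> z1; split=> [n|]; first exact: epow_integrable.
apply/cvg_ex; eexists; apply: (proj2 (abs_sum_exists _ _)).
apply: (abs_sum_le _ (fun n => exp_coeff (cmod x) n * 2)).
  move=> n; rewrite /Qterm !cmodM cmodX ler_pM ?mulr_ge0 ?cmod_ge0//.
  - by rewrite exprn_ge0// cmod_ge0.
  - rewrite /exp_coeff /= ler_wpM2l ?exprn_ge0 ?cmod_ge0//.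
    by rewrite -(rmorph_nat (real_complex R)) -fmorphV cmod_real ger0_norm// invr_ge0.
  - exact: cmod_pgf_le2.
rewrite (_ : series _ = (fun n => series (exp_coeff (cmod x)) n * 2)).
  by apply: is_cvgMr_tmp; exact: is_cvg_series_exp_coeff.
by apply/funext => n; rewrite /series /= mulr_suml.
Qed.

End GeneratingFunctions.

(** * The functional equation *)

Section PgfRecursion.
Context {R : realType} {dT : measure_display} {T : measurableType dT}.
Context {P : probability T R} {d : nat} {p : 'I_d -> R}.
Context {l : nat -> {RV P >-> enat}}.
Context {I : nat -> 'I_d -> {RV P >-> nat}} {L : nat -> 'I_d -> {RV P >-> enat}}.
Local Notation C := R[i].
Hypothesis hl : sicta_recursion p l I L.
Hypothesis hp : splitting_probability p.
Hypothesis hd : (2 <= d)%N.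

(** Independent summands give a Cauchy product of generating functions; the
    indicator [1{M < d}] is one more factor, with series [e], and the slots after
    [M] have generating function [1]. *)
Lemma stopped_length_abs_sum (z : C) n (f : 'I_d -> nat) :
  (forall m, complex_integrable P (fun w => epow z (l m w))) ->
  abs_sum (fun k => (stopped_length_mass (l := l) n k f)%:C * z ^+ k)
    (z ^+ (stop_slot n f < d)%N *
     \prod_(j < d | (j < stop_slot n f)%N) pgf P (l (f j)) z).
Proof.
move=> iz; set M := stop_slot n f; pose c := nat_of_bool (M < d)%N.
pose g (j : 'I_d) i : R := if (j < M)%N then mass P (l (f j)) i else (i == 0%N)%:R.
pose G (j : 'I_d) i : C := (g j i)%:C * z ^+ i.
pose s (j : 'I_d) := if (j < M)%N then pgf P (l (f j)) z else 1.
have Gs j : abs_sum (G j) (s j).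
  rewrite /G /g /s; case: ifP => _; first exact: pgf_abs_sum.
  have := abs_sum_finite (fun i => ((i == 0%N)%:R : R)%:C * z ^+ i) 1.
  by rewrite big_nat1 mul1r expr0; apply => -[|i]// _; rewrite mul0r.
pose e i : C := (i == c)%:R * z ^+ c.
have es : abs_sum e (z ^+ c).
  have <- : \sum_(0 <= i < c.+1) e i = z ^+ c.
    rewrite big_nat_recr//= /e eqxx mul1r big_nat big1 ?add0r// => i /andP[_ ic].
    by rewrite ltn_eqF// mul0r.
  by apply: abs_sum_finite => i ci; rewrite /e gtn_eqF// mul0r.
have prodG := abs_sum_prod _ (index_enum 'I_d) xpredT G s (fun j _ => Gs j).
rewrite -/c [X in _ * X]big_mkcond.
apply: eq_abs_sum (abs_sum_cauchy_product _ _ _ _ es prodG) => k.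
have GE (u : {ffun 'I_d -> 'I_k.+1}) :
    \prod_j G j (u j) = (\prod_j g j (u j))%:C * z ^+ (\sum_j u j).
  by rewrite big_split /= prodrXr rmorph_prod.
rewrite /stopped_length_mass -/M -/c rmorph_sum mulr_suml.
have [ck|kc] := leqP c k; last first.
  rewrite [RHS]big_pred0 => [|u]; last by rewrite gtn_eqF// ltn_addr.
  rewrite /cauchy_product big1// => i _; rewrite /e ltn_eqF ?mul0r//.
  by rewrite (leq_ltn_trans _ kc)// -ltnS.
have ck' : (c < k.+1)%N by rewrite ltnS.
rewrite /cauchy_product (bigD1 (Ordinal ck'))//= [X in _ + X]big1 ?addr0; last first.
  move=> i ic; rewrite /e -[X in (nat_of_ord i == X)]/(val (Ordinal ck')).
  by rewrite (inj_eq val_inj) (negPf ic) !mul0r.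
rewrite /e eqxx mul1r -(@coef_prod_poly_trunc _ _ _ _ _ (k - c) k) ?leq_subr//.
rewrite coef_prod_slots mulr_sumr; apply: eq_big => u.
  by rewrite -(eqn_add2l c) subnKC.
by move=> /eqP uk; rewrite GE mulrCA uk -exprD subnKC.
Qed.

(** The recursion for the laws, multiplied by [z ^+ k] and summed over [k].
    Convolutions of laws turn into products of absolutely convergent series. *)
Lemma pgf_recursion (z : C) n : (2 <= n)%N ->
  (forall m, complex_integrable P (fun w => epow z (l m w))) ->
  pgf P (l n) z = \sum_(f : {ffun 'I_d -> 'I_n.+1})
    (multinomial_pmf p n (fun j => f j))%:C *
    (z ^+ (stop_slot n (fun j => f j) < d)%N *
     \prod_(j < d | (j < stop_slot n (fun j => f j))%N) pgf P (l (f j)) z).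
Proof.
move=> n2 iz; apply: abs_sum_unique (pgf_abs_sum P (l n) z (iz n)) _.
pose V k (f : {ffun 'I_d -> 'I_n.+1}) : C := (multinomial_pmf p n (fun j => f j))%:C *
  ((stopped_length_mass (l := l) n k (fun j => f j))%:C * z ^+ k).
apply: (@eq_abs_sum _ (fun k => \sum_f V k f)); last first.
  apply: (abs_sum_bigsum _ _ _ (fun f k => V k f)) => f _.
  by apply: abs_sumZ; exact: stopped_length_abs_sum.
move=> k; rewrite /V.
rewrite (law_recursion hl n k n2) rmorph_sum mulr_suml.
by apply: eq_bigr => f _; rewrite rmorphM mulrA.
Qed.

Lemma pgf01 (z : C) n : (n < 2)%N ->
  (forall m, complex_integrable P (fun w => epow z (l m w))) ->
  pgf P (l n) z = z.
Proof. by move=> n2 iz; apply: pgf_ae_one => //; exact: sicta_init hl n n2. Qed.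

Lemma probability_le1 j : p j <= 1.
Proof.
by have [p0 <-] := hp; rewrite (bigD1 j)//= lerDl sumr_ge0.
Qed.

(** If all users always pick slot [i0], the recursion at [z = 1/2] says that the
    generating function of [l n] equals itself times a positive power of [1/2].
    It vanishes there, and so do all masses of [l n]: the resolution never ends. *)
Lemma mass_sure_slot (i0 : 'I_d) n k : p i0 = 1 -> (2 <= n)%N -> mass P (l n) k = 0.
Proof.
move=> pi0 n2; have [p0 psum] := hp.
have pj0 j : j != i0 -> p j = 0.
  move=> ji; apply/eqP; rewrite eq_le p0 andbT -(lerD2l (p i0)) addr0.
  rewrite [leRHS]pi0 -psum (bigD1 i0)//= lerD2l (bigD1 j)//= lerDl.
  by apply: sumr_ge0.
pose z : C := (2^-1)%:C.
have z1 : `|z| <= 1 by rewrite cmodE cmod_real ger0_norm ?invr_ge0// lecR invf_le1// ler1n.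
have iz m : complex_integrable P (fun w => epow z (l m w)) by exact: epow_integrable.
suff an0 : pgf P (l n) z = 0 by exact: (pgf_eq0_mass P (l n) 2^-1 _ (iz n) an0 k).
(* [f0] is the only vector of occupation numbers with positive probability. *)
pose f0 : {ffun 'I_d -> 'I_n.+1} := [ffun j => if j == i0 then ord_max else ord0].
have f0i : f0 i0 = n :> nat by rewrite ffunE eqxx.
have f0j j : j != i0 -> f0 j = 0%N :> nat by rewrite ffunE => /negPf ->.
have f0sum : (\sum_j f0 j = n)%N.
  by rewrite (bigD1 i0)//= f0i big1 ?addn0// => j /f0j.
pose M := stop_slot n (fun j => f0 j).
(* Slot [i0] is processed before stopping: the slots before it are empty. *)
have iM : (i0 < M)%N.
  rewrite ltnNge /M (stop_slotP _ _ _ f0sum)// big1 => [|j ji]; last first.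
    by rewrite f0j//; apply: contraTneq ji => ->; rewrite ltnn.
  by rewrite leqn0 subn_eq0 -ltnNge.
have Md : (M <= d)%N by exact: stop_slot_le.
pose m := ((M < d) + #|[pred j : 'I_d | (j < M)%N && (j != i0)]|)%N.
(* If the last slot is reached, there is no skipped slot, but [d >= 2] leaves an
   empty slot, which counts for one. *)
have m0 : m != 0%N.
  rewrite /m; have [//|dM] := ltnP M d; rewrite add0n -lt0n.
  have [j1 j1i] : exists j1 : 'I_d, j1 != i0.
    have d0 : (0 < d)%N by exact: ltnW.
    have [/eqP i00|i00] := boolP (i0 == Ordinal d0).
      by exists (Ordinal hd); rewrite i00.
    by exists (Ordinal d0); rewrite eq_sym.
  by apply/card_gt0P; exists j1; rewrite inE j1i (leq_trans (ltn_ord j1) dM).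
have an : pgf P (l n) z = z ^+ m * pgf P (l n) z.
  rewrite [LHS]pgf_recursion// (bigD1 f0)//= [X in _ + X]big1 ?addr0 => [|f ff0]; last first.
    rewrite /multinomial_pmf; case: eqP => [fn|_]; last by rewrite mul0r.
    have [j ji fj] : exists2 j, j != i0 & f j != 0%N :> nat.
      apply/exists_inP; apply: contraNT ff0; rewrite negb_exists_in => /forall_inP f0'.
      have fj0 j : j != i0 -> f j = 0%N :> nat by move=> /f0'; rewrite negbK => /eqP.
      apply/eqP/ffunP => j; apply: val_inj; have [->|ji] := eqVneq j i0; last first.
        by rewrite /= fj0// f0j.
      rewrite /= f0i -[RHS]fn (bigD1 i0)//= big1 ?addn0// => j' /fj0.
    by rewrite [X in (_ * X)%:C](bigD1 j)//= pj0// expr0n (negPf fj) mul0r mulr0 mul0r.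
  rewrite {1}/multinomial_pmf f0sum eqxx (bigD1 i0)//= f0i big1 ?muln1; last first.
    by move=> j /f0j ->; rewrite fact0.
  rewrite divff ?pnatr_eq0 -?lt0n ?fact_gt0// mul1r (bigD1 i0)//= pi0 expr1n mul1r.
  rewrite big1 => [|j /f0j ->]; last exact: expr0.
  rewrite mul1r (bigD1 i0)//= f0i mulrCA mulrC; congr (_ * _).
  rewrite (eq_bigr (fun=> z)) => [|j /andP[_ ji]]; last by rewrite f0j// pgf01.
  by rewrite prodr_const exprD.
apply/eqP; apply: contraT => an0.
have := congr1 cmod (mulIf an0 (etrans (mul1r _) an)).
rewrite cmod1 cmodX cmod_real ger0_norm ?invr_ge0// => zm.
have := exprn_ilt1 m (_ : 0 <= 2^-1 :> R) (_ : 2^-1 < 1).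
by rewrite -zm ltxx invr_ge0 ler0n invf_lt1 ?ltr1n// => ->.
Qed.

(** The series is only assumed to converge at [x].  If [p j < 1] then [x * p j] is
    either zero or closer to the origin, and the convergence is absolute; if
    [p j = 1] the series is a polynomial. *)
Lemma Qterm_slot_abs_cvg (x z : C) (j : 'I_d) : Qtilde_defined l x z ->
  abs_sum (Qterm l (x * (p j)%:C) z) (Qtilde l (x * (p j)%:C) z).
Proof.
move=> [iz cQ]; have [p0 _] := hp.
suff cvj : cvgn (series (fun n => cmod (Qterm l (x * (p j)%:C) z n))).
  by have h := abs_sum_exists _ cvj; rewrite /Qtilde (abs_sum_lim _ _ h).
have := probability_le1 j; rewrite le_eqVlt => /orP[/eqP pj1|pj1].
  apply: (proj1 (abs_sum_finite _ 2 _)) => n n2.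
  rewrite /Qterm -/(pgf P (l n) z) (_ : pgf P (l n) z = 0) ?mulr0//.
  apply: abs_sum_unique (pgf_abs_sum P (l n) z (iz n)) _.
  by apply: eq_abs_sum abs_sum0 => k; rewrite (mass_sure_slot j n k pj1 n2) mul0r.
rewrite (_ : (fun n => _) =
    (fun n => cmod ((x * (p j)%:C) ^+ n * (n`!%:R^-1 * pgf P (l n) z)))); last first.
  by apply/funext => n; rewrite mulrA.
apply: abs_cvg_power_series; first by rewrite p0.
rewrite (_ : (fun n => _) = Qterm l x z)//.
by apply/funext => n; rewrite mulrA.
Qed.

End PgfRecursion.

Theorem proposition1 (R : realType) (dT : measure_display)
    (T : measurableType dT) (P : probability T R)
    (d : nat) (hd : (2 <= d)%N)
    (p : 'I_d -> R) (hp : splitting_probability p)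
    (l : nat -> {RV P >-> enat})
    (I : nat -> 'I_d -> {RV P >-> nat}) (L : nat -> 'I_d -> {RV P >-> enat})
    (hl : sicta_recursion p l I L) :
  (forall x z : R[i], `|z| <= 1 -> Qtilde_defined l x z) /\
  (forall x z : R[i], Qtilde_defined l x z ->
    Qtilde l x z =
      \prod_(i < d) Qtilde l (x * (p i)%:C) z +
      \sum_(0 <= k < d.-1)
        (z - z ^+ 2) * (1 + (Fbar p k)%:C * x) *
        \prod_(i < d | (i < k)%N) Qtilde l (x * (p i)%:C) z).
Proof.
split=> [x z z1|x z Qxz]; first exact: Qtilde_defined_unit_disc.
have iz := Qxz.1.
pose b j n := Qterm l (x * (p j)%:C) z n : R[i].
have bs (j : 'I_d) : abs_sum (b j) (Qtilde l (x * (p j)%:C) z).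
  exact: Qterm_slot_abs_cvg hl hp hd x z j Qxz.
apply: (abs_sum_lim (Qterm l x z)).
have sum_tail k : abs_sum (fun n => (z - z ^+ 2) *
      ((1 + ((Fbar p k)%:C * x) *: 'X) *
       \prod_(j < d | (j < k)%N) \poly_(i < n.+1) b j i)`_n)
    ((z - z ^+ 2) * (1 + (Fbar p k)%:C * x) *
       \prod_(j < d | (j < k)%N) Qtilde l (x * (p j)%:C) z).
  rewrite -mulrA; apply/abs_sumZ/abs_sum_linear_factor => [|n].
    by apply: abs_sum_prod => j _; exact: bs.
  exact: coef_prod_poly_trunc.
have sum_prod := abs_sum_prod _ (index_enum 'I_d) xpredT b _ (fun j _ => bs j).
have sum_tails := abs_sum_bigsum _ (index_iota 0 d.-1) xpredT _ _ (fun k _ => sum_tail k).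
apply: eq_abs_sum (abs_sumD _ _ _ _ sum_prod sum_tails) => n.
apply/esym; apply: (coefficient_identity d p _ hp.2 x z (fun n => pgf P (l n) z)).
- exact: ltnW.
- exact: pgf01 hl _ _ _ iz.
- exact: pgf01 hl _ _ _ iz.
- by move=> m m2; exact: pgf_recursion hl z m m2 iz.
Qed.
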